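(* Let $\mathfrak{A}$ be a unital $C^*$-algebra, let $\mathscr{E},\mathscr{G}$ be inner product $\mathfrak{A}$-modules, and let $\mathscr{F}$ be a fully complemented submodule of $\mathscr{E}$. If $f:\mathscr{E}\to\mathscr{G}$ is orthogonally Jensen, then there exists a unique mapping $A:\mathscr{E}\to\mathscr{G}$ such that $A$ is additive on $\mathscr{F}$ and $f(x)=A(x)+f(0)$ for every $x\in\mathscr{F}$.
   Context: An inner product $\mathfrak{A}$-module is a (right) $\mathfrak{A}$-module $\mathscr{E}$ equipped with an $\mathfrak{A}$-valued inner product $\langle\cdot,\cdot\rangle$ which is $\mathbb{C}$-linear and $\mathfrak{A}$-linear in the second variable and satisfies $\langle x,y\rangle^*=\langle y,x\rangle$ and $\langle x,x\rangle\ge0$ with equality if and only if $x=0$. Completeness is not assumed. The norm is $\|x\|=\|\langle x,x\rangle\|^{1/2}$. A mapping $t:\mathscr{E}_1\to\mathscr{E}_2$ between inner product $\mathfrak{A}$-modules is adjointable if there is a mapping $t^*:\mathscr{E}_2\to\mathscr{E}_1$ with $\langle tx,y\rangle=\langle x,t^*y\rangle$ for all $x\in\mathscr{E}_1$, $y\in\mathscr{E}_2$. The modules are unitarily equivalent, $\mathscr{E}_1\sim\mathscr{E}_2$, if there is an adjointable $u:\mathscr{E}_1\to\mathscr{E}_2$ with $u^*u=\mathrm{id}_{\mathscr{E}_1}$ and $uu^*=\mathrm{id}_{\mathscr{E}_2}$. For a submodule $\mathscr{F}\subseteq\mathscr{E}$, $\mathscr{F}^\perp=\{x\in\mathscr{E}:\langle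 x,y\rangle=0\text{ for all }y\in\mathscr{F}\}$. A closed submodule $\mathscr{F}$ of $\mathscr{E}$ is orthogonally complemented if $\mathscr{F}\oplus\mathscr{F}^\perp=\mathscr{E}$, and fully complemented if it is orthogonally complemented and $\mathscr{F}^\perp\sim\mathscr{E}$. $f:\mathscr{E}\to\mathscr{G}$ is orthogonally Jensen if for all $x,y\in\mathscr{E}$, $\langle x,y\rangle=0$ implies $f\big(\tfrac12x+\tfrac12y\big)=\tfrac12f(x)+\tfrac12f(y)$. $A$ is additive on $\mathscr{F}$ if $A(x+y)=A(x)+A(y)$ for all $x,y\in\mathscr{F}$.
   Formalization: Uniqueness of A is asserted only for its values on F, since the conditions do not constrain A outside F; with F = {0}, E = G = ℓ² and f = 0, both A = 0 and A = id satisfy them, so literal uniqueness on E fails. *)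

(* Defs.v *)
From HB Require Import structures.
From mathcomp Require Import all_boot all_order all_algebra.
From mathcomp Require Import all_classical all_reals all_analysis.
From mathcomp Require Export complex.

Set Implicit Arguments.
Unset Strict Implicit.
Unset Printing Implicit Defensive.
Import Order.TTheory GRing.Theory Num.Theory.
Import numFieldNormedType.Exports.

Local Open Scope classical_set_scope.
Local Open Scope complex_scope.
Local Open Scope ring_scope.

(* The norm is an operation of the mixin: Hierarchy Builder does not allow a
   structure to join [GRing.Algebra] and [NormedModule] above [numDomainType].
   As for every [algType], [1 != 0]. *)
HB.mixin Record isUnitalCStar (R : realType) A of GRing.Algebra R[i] A := {
  star : A -> A;
  cnorm : A -> R;
  starK : involutive star;
  starD : {morph star : a b / a + b};
  starZ : forall (l : R[i]) (a : A), star (l *: a) = l^* *: star a;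
  starM : forall a b : A, star (a * b) = star b * star a;
  cnormD : forall a b : A, cnorm (a + b) <= cnorm a + cnorm b;
  cnormZ : forall (l : R[i]) (a : A), cnorm (l *: a) = Normc.normc l * cnorm a;
  cnorm_eq0 : forall a : A, cnorm a = 0 -> a = 0;
  cnormM : forall a b : A, cnorm (a * b) <= cnorm a * cnorm b;
  cnorm_star : forall a : A, cnorm (star a * a) = cnorm a ^+ 2;
  cnorm_complete : forall s : nat -> A,
    (forall e : R, 0 < e -> exists N, forall m n,
      (N <= m)%N -> (N <= n)%N -> cnorm (s m - s n) < e) ->
    exists a : A, forall e : R, 0 < e -> exists N, forall n,
      (N <= n)%N -> cnorm (s n - a) < e
}.

#[short(type="unitalCStarType")]
HB.structure Definition UnitalCStar (R : realType) :=
  {A of GRing.Algebra R[i] A & isUnitalCStar R A}.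

Section Positive.
Context {R : realType} {A : unitalCStarType R}.

Definition invertible (a : A) := exists b : A, a * b = 1 /\ b * a = 1.

Definition spectrum (a : A) : set R[i] :=
  [set l | ~ invertible (a - l%:A)].

(* The order of [R[i]] satisfies [0 <= l] iff [l] is a nonnegative real. *)
Definition positive (a : A) :=
  star a = a /\ forall l, spectrum a l -> 0 <= l.

End Positive.

HB.mixin Record isInnerModule (R : realType) (A : unitalCStarType R) E
    of GRing.Lmodule R[i] E := {
  ract : E -> A -> E;
  ractDl : forall (x y : E) (a : A), ract (x + y) a = ract x a + ract y a;
  ractDr : forall (x : E) (a b : A), ract x (a + b) = ract x a + ract x b;
  ractM : forall (x : E) (a b : A), ract x (a * b) = ract (ract x a) b;
  ract1 : forall x : E, ract x 1 = x;
  ractZl : forall (l : R[i]) (x : E) (a : A), ract (l *: x) a = l *: ract x a;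
  ractZr : forall (l : R[i]) (x : E) (a : A), ract x (l *: a) = l *: ract x a;
  ip : E -> E -> A;
  ipDr : forall x y z : E, ip x (y + z) = ip x y + ip x z;
  ipZr : forall (l : R[i]) (x y : E), ip x (l *: y) = l *: ip x y;
  ip_ract : forall (x y : E) (a : A), ip x (ract y a) = ip x y * a;
  ip_star : forall x y : E, star (ip x y) = ip y x;
  ip_ge0 : forall x : E, positive (ip x x);
  ip_eq0 : forall x : E, ip x x = 0 <-> x = 0
}.

#[short(type="innerModType")]
HB.structure Definition InnerModule (R : realType) (A : unitalCStarType R) :=
  {E of GRing.Lmodule R[i] E & isInnerModule R A E}.

Definition ipnorm (R : realType) (A : unitalCStarType R) (E : innerModType A)
  (x : E) : R := Num.sqrt (cnorm (ip x x)).

Record submodule (R : realType) (A : unitalCStarType R) (E : innerModType A) :=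
  Submodule {
    carrier :> set E;
    subm0 : carrier 0;
    submD : forall x y, carrier x -> carrier y -> carrier (x + y);
    submZ : forall (l : R[i]) x, carrier x -> carrier (l *: x);
    subm_ract : forall x (a : A), carrier x -> carrier (ract x a)
  }.

Section SubmoduleType.
Context {R : realType} {A : unitalCStarType R} {E : innerModType A}.
Variable F : submodule E.

Definition subm_pred : {pred E} := fun x => x \in (F : set E).

Lemma subm_predP x : reflect (carrier F x) (x \in subm_pred).
Proof. by apply: (iffP idP) => [/set_mem|/mem_set]. Qed.

Fact subm_pred_closed : subsemimod_closed subm_pred.
Proof.
split; first split.
- exact/subm_predP/subm0.
- by move=> x y /subm_predP Fx /subm_predP Fy; apply/subm_predP/submD.
- by move=> l x /subm_predP Fx; apply/subm_predP/submZ.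
Qed.

Record subm_type := SubmType {
  subm_val :> E;
  subm_valP : subm_val \in subm_pred
}.

HB.instance Definition _ := [isSub for subm_val].
HB.instance Definition _ := [Choice of subm_type by <:].
HB.instance Definition _ := GRing.SubChoice_isSubLmodule.Build
  R[i] E subm_pred subm_type subm_pred_closed.

Fact subm_ractP (x : subm_type) (a : A) : ract (\val x) a \in subm_pred.
Proof. by apply/subm_predP/subm_ract/subm_predP/(valP x). Qed.

Definition subm_type_ract (x : subm_type) (a : A) : subm_type :=
  SubmType (subm_ractP x a).

Definition subm_type_ip (x y : subm_type) : A := ip (\val x) (\val y).

Fact subm_type_ractDl (x y : subm_type) a :
  subm_type_ract (x + y) a = subm_type_ract x a + subm_type_ract y a.
Proof.
apply/val_inj; rewrite [RHS]raddfD -[LHS]/(ract (\val (x + y)) a) raddfD.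
exact: ractDl.
Qed.

Fact subm_type_ractDr (x : subm_type) a b :
  subm_type_ract x (a + b) = subm_type_ract x a + subm_type_ract x b.
Proof. by apply/val_inj; rewrite [RHS]raddfD; exact: ractDr. Qed.

Fact subm_type_ractM (x : subm_type) a b :
  subm_type_ract x (a * b) = subm_type_ract (subm_type_ract x a) b.
Proof. by apply/val_inj; exact: ractM. Qed.

Fact subm_type_ract1 (x : subm_type) : subm_type_ract x 1 = x.
Proof. by apply/val_inj; exact: ract1. Qed.

Fact subm_type_ractZl (l : R[i]) (x : subm_type) a :
  subm_type_ract (l *: x) a = l *: subm_type_ract x a.
Proof.
apply/val_inj; rewrite [RHS]linearZ -[LHS]/(ract (\val (l *: x)) a) linearZ.
exact: ractZl.
Qed.

Fact subm_type_ractZr (l : R[i]) (x : subm_type) a :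
  subm_type_ract x (l *: a) = l *: subm_type_ract x a.
Proof. by apply/val_inj; rewrite [RHS]linearZ; exact: ractZr. Qed.

Fact subm_type_ipDr (x y z : subm_type) :
  subm_type_ip x (y + z) = subm_type_ip x y + subm_type_ip x z.
Proof. by rewrite /subm_type_ip raddfD ipDr. Qed.

Fact subm_type_ipZr (l : R[i]) (x y : subm_type) :
  subm_type_ip x (l *: y) = l *: subm_type_ip x y.
Proof. by rewrite /subm_type_ip linearZ ipZr. Qed.

Fact subm_type_ip_ract (x y : subm_type) a :
  subm_type_ip x (subm_type_ract y a) = subm_type_ip x y * a.
Proof. exact: ip_ract. Qed.

Fact subm_type_ip_star (x y : subm_type) :
  star (subm_type_ip x y) = subm_type_ip y x.
Proof. exact: ip_star. Qed.

Fact subm_type_ip_ge0 (x : subm_type) : positive (subm_type_ip x x).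
Proof. exact: ip_ge0. Qed.

Fact subm_type_ip_eq0 (x : subm_type) : subm_type_ip x x = 0 <-> x = 0.
Proof.
split; first by move=> /ip_eq0 x0; apply/val_inj; rewrite x0 raddf0.
by move=> ->; apply/ip_eq0; rewrite raddf0.
Qed.

HB.instance Definition _ := isInnerModule.Build R A subm_type
  subm_type_ractDl subm_type_ractDr subm_type_ractM subm_type_ract1
  subm_type_ractZl subm_type_ractZr subm_type_ipDr subm_type_ipZr
  subm_type_ip_ract subm_type_ip_star subm_type_ip_ge0 subm_type_ip_eq0.

End SubmoduleType.

Section Complement.
Context {R : realType} {A : unitalCStarType R}.

(* [t] is adjointable when [is_adjoint t s] for some [s], and then [s = t^*];
   neither map is assumed to be linear. *)
Definition is_adjoint (E1 E2 : innerModType A) (t : E1 -> E2) (s : E2 -> E1) :=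
  forall x y, ip (t x) y = ip x (s y).

Definition unitarily_equivalent (E1 E2 : innerModType A) :=
  exists (u : E1 -> E2) (us : E2 -> E1),
    [/\ is_adjoint u us, us \o u = id & u \o us = id].

Variable E : innerModType A.
Implicit Type F : submodule E.

Definition orth_set (F : set E) : set E :=
  [set x | forall y, F y -> ip x y = 0].

Fact ip0r (x : E) : ip x 0 = 0 :> A.
Proof. by rewrite -(scale0r (0 : E)) ipZr scale0r. Qed.

Fact star0 : star (0 : A) = 0.
Proof.
have /eqP := starD (0 : A) 0; rewrite addr0 -subr_eq0 opprD addrA subrr sub0r.
by rewrite oppr_eq0 => /eqP.
Qed.

Fact orth_setP (F : set E) x :
  orth_set F x <-> forall y, F y -> ip y x = 0 :> A.
Proof.
by split=> Fx y Fy; rewrite -[LHS]ip_star Fx // star0.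
Qed.

Fact orth0 F : orth_set F 0.
Proof. by apply/orth_setP => y _; rewrite ip0r. Qed.

Fact orthD F x y : orth_set F x -> orth_set F y -> orth_set F (x + y).
Proof.
move=> /orth_setP Fx /orth_setP Fy; apply/orth_setP => z Fz.
by rewrite ipDr Fx // Fy // addr0.
Qed.

Fact orthZ F (l : R[i]) x : orth_set F x -> orth_set F (l *: x).
Proof.
by move=> /orth_setP Fx; apply/orth_setP => z Fz; rewrite ipZr Fx // scaler0.
Qed.

Fact orth_ract F x (a : A) : orth_set F x -> orth_set F (ract x a).
Proof.
by move=> /orth_setP Fx; apply/orth_setP => z Fz; rewrite ip_ract Fx // mul0r.
Qed.

Definition orth F : submodule E :=
  Submodule (@orth0 F) (@orthD F) (@orthZ F) (@orth_ract F).

Definition ip_closed (F : set E) :=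
  forall x, (forall e : R, 0 < e -> exists2 y, F y & ipnorm (x - y) < e) ->
    F x.

Definition orth_complemented F :=
  [/\ ip_closed F,
      forall x, exists y z, [/\ carrier F y, carrier (orth F) z & x = y + z] &
      forall x, carrier F x -> carrier (orth F) x -> x = 0].

Definition fully_complemented F :=
  orth_complemented F /\ unitarily_equivalent (subm_type (orth F)) E.

Definition orthogonally_jensen (G : innerModType A) (f : E -> G) :=
  forall x y : E, ip x y = 0 :> A ->
    f ((2^-1 : R[i]) *: x + (2^-1 : R[i]) *: y) =
      (2^-1 : R[i]) *: f x + (2^-1 : R[i]) *: f y.

Definition additive_on (G : innerModType A) (F : set E) (h : E -> G) :=
  forall x y, F x -> F y -> h (x + y) = h x + h y.

End Complement.

(* Main.v *)
Require Import Defs.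
From mathcomp Require Import all_boot all_order all_algebra.
From mathcomp Require Import all_classical all_reals all_analysis.

(** Put [g x = f x - f 0]. Then [g] is additive on orthogonal pairs and
    [g (x / 2) = g x / 2]; let [B x y = g (x + y) - g x - g y], so [B] vanishes
    on orthogonal pairs and [B (x / 2) (y / 2) = B x y / 2].  Since [F^perp ~ E],
    there is an inner product preserving [v : E -> E] with range in [F^perp], so
    that [F], [v F] and [v (v F)] are mutually orthogonal copies of [F].  For
    [x, y] in [F], [B] splits over these copies, and comparing two orthogonal
    pairs supported on two and on three copies gives [B x y = 2 B x (y / 2)].
    By symmetry [B x y = 4 B (x / 2) (y / 2) = 2 B x y], so [B x y = 0]. *)

Import GRing.Theory Num.Theory.
Local Open Scope ring_scope.

Lemma scale2V_mulr2n (K : numFieldType) (V : lmodType K) (x : V) :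
  (2^-1 : K) *: x *+ 2 = x.
Proof. by rewrite -scaler_nat scalerA mulfV ?scale1r ?pnatr_eq0. Qed.

Section InnerProduct.
Set Implicit Arguments.
Unset Strict Implicit.
Context {R : realType} {A : unitalCStarType R}.

Lemma ipDl (E : innerModType A) (x y z : E) :
  ip (x + y) z = ip x z + ip y z :> A.
Proof. by rewrite -ip_star ipDr starD !ip_star. Qed.

Lemma ipNr (E : innerModType A) (x y : E) : ip x (- y) = - ip x y :> A.
Proof. by rewrite -scaleN1r ipZr scaleN1r. Qed.

Lemma ipNl (E : innerModType A) (x y : E) : ip (- x) y = - ip x y :> A.
Proof.
by apply/eqP; rewrite -subr_eq0 opprK -ipDl addNr -ip_star ip0r star0.
Qed.

Definition ip_preserving (E1 E2 : innerModType A) (v : E1 -> E2) :=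
  forall x y, ip (v x) (v y) = ip x y :> A.

(** The error [v (x + y) - (v x + v y)] is orthogonal to every [v z], hence to itself. *)
Lemma ip_preservingD (E1 E2 : innerModType A) (v : E1 -> E2) :
  ip_preserving v -> {morph v : x y / x + y}.
Proof.
move=> vip x y; apply/eqP; rewrite -subr_eq0; apply/eqP/ip_eq0.
have orthv z : ip (v z) (v (x + y) - (v x + v y)) = 0 :> A.
  by rewrite ipDr ipNr ipDr !vip ipDr subrr.
by rewrite ipDl ipNl ipDl !orthv addr0 subr0.
Qed.

(** Take [v] to be the adjoint [us] followed by the inclusion; adjointness and [u \o us = id] make
    it preserve [ip]. *)
Lemma unitarily_equivalent_orthP (E : innerModType A) (F : submodule E) :
  unitarily_equivalent (subm_type (orth F)) E ->
  exists2 v : E -> E, ip_preserving v & forall x, carrier (orth F) (v x).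
Proof.
move=> [u [us [adj usK uK]]]; exists (fun x => \val (us x)).
  move=> x y; rewrite -[LHS]/(ip (us x) (us y)) -adj.
  by rewrite -[u (us x)]/((u \o us) x) uK.
by move=> x; exact/subm_predP/(valP (us x)).
Qed.

End InnerProduct.

Section OrthogonallyAdditive.
Set Implicit Arguments.
Unset Strict Implicit.
Context {R : realType} {A : unitalCStarType R} {E G : innerModType A}.
Implicit Types (F : submodule E) (g : E -> G) (v : E -> E).

Definition orth_additive g :=
  forall x y, ip x y = 0 :> A -> g (x + y) = g x + g y.

Definition defect g (x y : E) : G := g (x + y) - (g x + g y).

Lemma defectC g x y : defect g x y = defect g y x.
Proof. by rewrite /defect (addrC x) (addrC (g x)). Qed.

Lemma orth_additive_comp g v :
  ip_preserving v -> orth_additive g -> orth_additive (g \o v).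
Proof.
by move=> vip gadd x y xy0; rewrite /= ip_preservingD // gadd // vip.
Qed.

(** [F] is orthogonal to the range of [v], so [g] splits at both arguments and at their sum
    [(a + c) + v (b + d)]. *)
Lemma defect_split F g v :
  ip_preserving v -> (forall x, carrier (orth F) (v x)) -> orth_additive g ->
  forall a b c d, carrier F a -> carrier F c ->
  defect g (a + v b) (c + v d) = defect g a c + defect (g \o v) b d.
Proof.
move=> vip vF gadd a b c d Fa Fc.
have gD x y : carrier F x -> g (x + v y) = g x + g (v y).
  by move=> Fx; apply: gadd; apply/orth_setP: x Fx; exact: vF.
rewrite /defect (addrACA a) -(ip_preservingD vip) !gD //; last exact: submD.
by rewrite [RHS]addrACA -opprD; congr (_ - _); exact: addrACA.
Qed.

(** The vectors [x + v w] and [y + v z] are orthogonal: cross terms vanish and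
    [ip x y + ip w z = 0]. Their defect is thus zero, and it splits. *)
Lemma defect_swap F g v :
  ip_preserving v -> (forall x, carrier (orth F) (v x)) -> orth_additive g ->
  forall x y w z, carrier F x -> carrier F y -> ip w z = - ip x y :> A ->
  defect (g \o v) w z = - defect g x y.
Proof.
move=> vip vF gadd x y w z Fx Fy wz.
apply/eqP; rewrite -subr_eq0 opprK addrC -(defect_split (F := F)) // /defect gadd.
  by rewrite subrr.
have Fv u t : carrier F u -> ip u (v t) = 0 :> A.
  by move=> Fu; apply/orth_setP: u Fu; exact: vF.
by rewrite ipDl !ipDr vip Fv // [ip (v w) y]vF // wz addr0 add0r subrr.
Qed.

Lemma defect_half F g v :
  ip_preserving v -> (forall x, carrier (orth F) (v x)) -> orth_additive g ->
  forall x y, carrier F x -> carrier F y ->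
  defect g x y = defect g x ((2^-1 : R[i]) *: y) *+ 2.
Proof.
move=> vip vF gadd x y Fx Fy; set y2 := _ *: y.
have Fy2 : carrier F y2 by exact: submZ.
have FN2 : carrier F (- y2) by rewrite -scaleN1r; exact: submZ.
have y2D : y = y2 + y2.
  by rewrite -mulr2n scale2V_mulr2n.
have vvip : ip_preserving (v \o v) by move=> a b; rewrite /= !vip.
have vvF a : carrier (orth F) ((v \o v) a) by exact: vF.
(* Each of the two copies contributes [- ip x y2], half of the required value. *)
have vxy : ip (x + v x) (- y2 + v (- y2)) = - ip x y :> A.
  rewrite ipDl !ipDr vip [ip (v x) _]vF //.
  have /orth_setP -> // := vF (- y2).
  by rewrite addr0 add0r !ipNr y2D ipDr opprD.
apply: oppr_inj; rewrite -(defect_swap vip vF gadd Fx Fy vxy).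
(* Both summands are defects at [(x, - y2)], one for [g \o v] and one for [g \o v \o v]; each equals
   [- defect g x y2]. *)
rewrite (defect_split (F := F)) //; last exact: orth_additive_comp.
rewrite (defect_swap vip vF gadd Fx Fy2) ?ipNr //.
rewrite (defect_swap vvip vvF gadd Fx Fy2) ?ipNr //.
by rewrite -opprD -mulr2n.
Qed.

Lemma orth_additive_additive_on F g :
  unitarily_equivalent (subm_type (orth F)) E -> orth_additive g ->
  (forall x, g ((2^-1 : R[i]) *: x) = (2^-1 : R[i]) *: g x) ->
  additive_on F g.
Proof.
move=> /unitarily_equivalent_orthP[v vip vF] gadd ghalf x y Fx Fy.
apply/eqP; rewrite -subr_eq0; apply/eqP; rewrite -/(defect g x y).
have defect_halves :
    defect g ((2^-1 : R[i]) *: x) ((2^-1 : R[i]) *: y)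
      = (2^-1 : R[i]) *: defect g x y.
  by rewrite /defect -scalerDr !ghalf -scalerDr -scalerBr.
have Fy2 : carrier F ((2^-1 : R[i]) *: y) by exact: submZ.
have := defect_half vip vF gadd Fx Fy.
(* By symmetry the first argument can be halved too. *)
rewrite defectC [defect g x (_ *: _)]defectC.
rewrite (defect_half vip vF gadd Fy2 Fx) defectC.
rewrite [defect g (_ *: _) _]defectC defect_halves scale2V_mulr2n mulr2n => /eqP.
by rewrite -subr_eq0 opprD addNKr oppr_eq0 => /eqP.
Qed.

Lemma orthogonally_jensen_half (f : E -> G) : orthogonally_jensen f ->
  forall x, f ((2^-1 : R[i]) *: x) - f 0 = (2^-1 : R[i]) *: (f x - f 0).
Proof.
move=> fJ x; have := fJ x 0 (ip0r x); rewrite scaler0 addr0 => ->.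
rewrite scalerBr -addrA; congr (_ + _).
by rewrite -[X in _ - X]scale2V_mulr2n mulr2n opprD addrA subrr add0r.
Qed.

(** Halving is injective, and after halving both sides the Jensen identity for [x], [y] applies. *)
Lemma orthogonally_jensen_orth_additive (f : E -> G) :
  orthogonally_jensen f -> orth_additive (fun x => f x - f 0).
Proof.
move=> fJ x y xy0.
have half_inj : injective (fun z : G => (2^-1 : R[i]) *: z).
  by apply: scalerI; rewrite invr_eq0 pnatr_eq0.
apply: half_inj; rewrite -orthogonally_jensen_half // scalerDr fJ //.
by rewrite addrACA -opprD scalerBr scalerDr -mulr2n -scalerMnr scale2V_mulr2n.
Qed.

End OrthogonallyAdditive.

Theorem corollary2p10 (R : realType) (A : unitalCStarType R)
    (E G : innerModType A) (F : submodule E) (hF : fully_complemented F)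
    (f : E -> G) (hf : orthogonally_jensen f) :
  exists T : E -> G,
    [/\ additive_on F T,
        (forall x, carrier F x -> f x = T x + f 0) &
        (* uniqueness; the two conditions only constrain values on [F] *)
        forall T' : E -> G, additive_on F T' ->
          (forall x, carrier F x -> f x = T' x + f 0) ->
          forall x, carrier F x -> T' x = T x].
Proof.
(* The required equation forces this value on [F], whence uniqueness. *)
exists (fun x => f x - f 0); split.
- apply: orth_additive_additive_on; first exact: hF.2.
    exact: orthogonally_jensen_orth_additive.
  exact: orthogonally_jensen_half.
- by move=> x _; rewrite subrK.
- by move=> T' _ fT' x Fx; rewrite fT' // addrK.
Qed.
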